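(* Let $P\subseteq\mathbb{R}^d$ be a full-dimensional convex polytope with $0\in P$. Then the intersection body $IP$ of $P$ is a semialgebraic subset of $\mathbb{R}^d$.
   Context: For a convex body (nonempty compact convex set) $K\subset\mathbb{R}^d$, its intersection body is defined via its radial function: for $x\in\mathbb{R}^d\setminus\{0\}$ set $\rho_{IK}(x)=\frac{1}{\|x\|}\operatorname{Vol}_{d-1}(K\cap x^\perp)$, where $x^\perp=\{y:\langle x,y\rangle=0\}$ and $\operatorname{Vol}_{d-1}$ is $(d-1)$-dimensional Euclidean volume, and $IK=\{x\in\mathbb{R}^d\setminus\{0\}:\rho_{IK}(x)\ge 1\}\cup\{0\}$. A set is semialgebraic if it is a finite Boolean combination of sets defined by polynomial inequalities with real coefficients. *)

(* Defs.v *)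
From HB Require Import structures.
From mathcomp Require Import all_boot all_order all_algebra.
From mathcomp Require Import all_classical all_reals all_analysis.
From mathcomp Require mpoly.
Set Implicit Arguments. Unset Strict Implicit. Unset Printing Implicit Defensive.
Import Order.TTheory GRing.Theory Num.Theory.
Import numFieldNormedType.Exports.
Local Open Scope classical_set_scope.
Local Open Scope ring_scope.

Section IntersectionBody.
Variable R : realType.

(* Euclidean norm of a row vector (the library's norm on 'rV is the max norm). *)
Definition enorm (d : nat) (x : 'rV[R]_d) : R := Num.sqrt (\sum_i x 0 i ^+ 2).

(* d-dimensional Lebesgue volume, defined as the iterated Lebesgue integral of
   the indicator function (Tonelli): vol_0 A = [0 \in A],
   vol_{n+1} A = \int (vol_n of the section of A at first coordinate t) dt. *)
Fixpoint vol (n : nat) : set 'rV[R]_n -> \bar R :=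
  match n return set 'rV[R]_n -> \bar R with
  | 0 => fun A => if `[< A 0 >] then 1%E else 0%E
  | n'.+1 => fun A =>
      (\int[@lebesgue_measure R]_t
          vol [set v : 'rV[R]_n' | A (row_mx (const_mx t : 'rV[R]_1) v)])%E
  end.

(* B has orthonormal rows, all orthogonal to x: for x <> 0 (and d >= 1) its
   d-1 rows form an orthonormal basis of the hyperplane x^perp, so that
   z |-> z *m B is a linear isometry from R^(d-1) onto x^perp. *)
Definition perp_frame (d : nat) (x : 'rV[R]_d) (B : 'M[R]_(d.-1, d)) : Prop :=
  B *m B^T = 1%:M /\ B *m x^T = 0.

(* (d-1)-dimensional volume of K \cap x^perp, computed via a chosen isometric
   parametrisation of x^perp (the value does not depend on the choice). *)
Definition section_vol (d : nat) (K : set 'rV[R]_d) (x : 'rV[R]_d) : \bar R :=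
  vol [set z : 'rV[R]_d.-1 | K (z *m xget 0 (perp_frame x))].

Definition radial_IK (d : nat) (K : set 'rV[R]_d) (x : 'rV[R]_d) : \bar R :=
  (section_vol K x * ((enorm x)^-1)%:E)%E.

Definition intersection_body (d : nat) (K : set 'rV[R]_d) : set 'rV[R]_d :=
  [set x | (x != 0 /\ (1 <= radial_IK K x)%E) \/ x = 0].

Definition is_polytope (d : nat) (P : set 'rV[R]_d) : Prop :=
  exists (m : nat) (V : 'M[R]_(m, d)),
    P = [set x | exists lam : 'rV[R]_m,
                   (forall i, 0 <= lam 0 i) /\ \sum_i lam 0 i = 1 /\ x = lam *m V].

Definition full_dimensional (d : nat) (P : set 'rV[R]_d) : Prop :=
  interior P !=set0.

Inductive semialgebraic (d : nat) : set 'rV[R]_d -> Prop :=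
| sa_le (p : mpoly.mpoly d R) :
    semialgebraic [set x | 0 <= mpoly.meval (fun i => x 0 i) p]
| sa_lt (p : mpoly.mpoly d R) :
    semialgebraic [set x | 0 < mpoly.meval (fun i => x 0 i) p]
| sa_compl A : semialgebraic A -> semialgebraic (~` A)
| sa_union A B : semialgebraic A -> semialgebraic B -> semialgebraic (A `|` B)
| sa_inter A B : semialgebraic A -> semialgebraic B -> semialgebraic (A `&` B).

End IntersectionBody.

(* Main.v *)
Require Import Defs.
From HB Require Import structures.
From mathcomp Require Import all_boot all_order all_algebra.
From mathcomp Require Import all_classical all_reals all_analysis.
From mathcomp Require Import measurable_realfun ring lra.
From mathcomp Require mpoly.
Set Implicit Arguments. Unset Strict Implicit. Unset Printing Implicit Defensive.
Import Order.TTheory GRing.Theory Num.Theory.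
Import numFieldNormedType.Exports.
Local Open Scope classical_set_scope.
Local Open Scope ring_scope.

(** For x <> 0, thicken the section P \cap x^perp into the slab
    Q_x = {w : proj_{x^perp} w in P, 0 <= <w, x> <= |x|^2}.  In the orthonormal coordinates
    given by x / |x| and the chosen frame of x^perp the slab is a product, so
    vol Q_x = |x| vol (P \cap x^perp) and x lies in IP iff |x|^2 <= vol Q_x; only invariance
    of the iterated integral under orthogonal matrices is needed, and the frame disappears.
    Membership in Q_x is decided by testing signs of affine forms in w whose coefficients are
    rational functions of x.  Integrating out one coordinate of w at a time keeps this shape:
    a function given by a decision tree with affine tests and polynomial leaves is integrated
    by cutting the interval at the roots of the tests, and the ends of the pieces are again
    affine forms in the remaining coordinates.  Hence vol Q_x is a piecewise rational function
    of x.  The same cutting argument, applied to "there exists t" instead of the integral, is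
    Fourier-Motzkin elimination and describes P itself by affine tests. *)

(** * Decision trees *)

Section Trees.
Variable R : realType.

(** A predicate on functions rather than a datatype: only closure properties of the tests [A] and
    the leaves [L] are used, and both classes change each time a variable is added. *)
Inductive tree (Y T : Type) (A : (Y -> R) -> Prop) (L : (Y -> T) -> Prop) :
    (Y -> T) -> Prop :=
| tree_leaf f : L f -> tree A L f
| tree_node a f g : A a -> tree A L f -> tree A L g ->
    tree A L (fun y => if 0 <= a y then f y else g y).

Lemma tree_ext Y T A L (f g : Y -> T) : f =1 g -> tree A L f -> tree A L g.
Proof. by move=> /funext ->. Qed.

(** Grafting: after pulling the tests back along [h], each leaf is replaced by a whole tree. As
    [phi] sees the point [y], a second tree can be carried along while the first is traversed. *)
Lemma tree_bind Y Y' T T' (A : (Y -> R) -> Prop) (A' : (Y' -> R) -> Prop) L L'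
    (h : Y' -> Y) (phi : Y' -> T -> T') (f : Y -> T) :
  (forall a, A a -> A' (a \o h)) ->
  (forall l, L l -> tree A' L' (fun y => phi y (l (h y)))) ->
  tree A L f -> tree A' L' (fun y => phi y (f (h y))).
Proof.
move=> hA hL; elim=> [l /hL//|a f1 f2 /hA Aa _ IH1 _ IH2].
apply: tree_ext (tree_node Aa IH1 IH2) => y /=.
by case: ifP.
Qed.

Lemma tree_pull Y Y' T (A : (Y -> R) -> Prop) (A' : (Y' -> R) -> Prop) L L'
    (h : Y' -> Y) (f : Y -> T) :
  (forall a, A a -> A' (a \o h)) -> (forall l, L l -> L' (l \o h)) ->
  tree A L f -> tree A' L' (f \o h).
Proof.
move=> hA hL; apply: (tree_bind (phi := fun _ => id)) => // l Ll.
exact/tree_leaf/hL.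
Qed.

Lemma tree_op2 Y T1 T2 T3 (A : (Y -> R) -> Prop) L1 L2 L3
    (op : T1 -> T2 -> T3) (f : Y -> T1) (g : Y -> T2) :
  (forall l1 l2, L1 l1 -> L2 l2 -> L3 (fun y => op (l1 y) (l2 y))) ->
  tree A L1 f -> tree A L2 g -> tree A L3 (fun y => op (f y) (g y)).
Proof.
move=> hL tf tg.
apply: (tree_bind (h := id) (phi := fun y t => op t (g y)) _ _ tf) => // l1 Ll1.
apply: (tree_bind (h := id) (phi := fun y t => op (l1 y) t) _ _ tg) => // l2 Ll2.
exact/tree_leaf/hL.
Qed.

Definition is_const Y T (l : Y -> T) := exists c, l = fun=> c.

(* Integration by one variable at a time: [K] are coefficients, which do not involve the
   variables already introduced, [A] affine forms in these variables, and [Q] the leaves,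
   polynomial in them.  The [ext_] versions below add one more real variable. *)
Record coeff_field Y (K : (Y -> R) -> Prop) : Prop := {
  coeff_cst : forall c, K (fun=> c);
  coeff_add : forall f g, K f -> K g -> K (fun y => f y + g y);
  coeff_mul : forall f g, K f -> K g -> K (fun y => f y * g y);
  coeff_inv : forall f, K f -> K (fun y => (f y)^-1) }.

Record forms Y (K A : (Y -> R) -> Prop) : Prop := {
  forms_coeff : forall k, K k -> A k;
  forms_add : forall a b, A a -> A b -> A (fun y => a y + b y);
  forms_mul : forall k a, K k -> A a -> A (fun y => k y * a y) }.

Record form_module Y (A Q : (Y -> R) -> Prop) : Prop := {
  fmod_cst : forall c, Q (fun=> c);
  fmod_add : forall p q, Q p -> Q q -> Q (fun y => p y + q y);
  fmod_mul : forall a q, A a -> Q q -> Q (fun y => a y * q y) }.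

Definition ext_coeff Y (K : (Y -> R) -> Prop) (k' : Y * R -> R) : Prop :=
  exists2 k, K k & k' = k \o fst.

Definition ext_form Y (K A : (Y -> R) -> Prop) (a' : Y * R -> R) : Prop :=
  exists a k, [/\ A a, K k & a' = fun yt => a yt.1 + k yt.1 * yt.2].

(* Polynomials in the new variable with coefficients in [Q], in Horner form. *)
Inductive ext_mod Y (Q : (Y -> R) -> Prop) : (Y * R -> R) -> Prop :=
| ext_mod_cst q : Q q -> ext_mod Q (q \o fst)
| ext_mod_horner q f : Q q -> ext_mod Q f ->
    ext_mod Q (fun yt => q yt.1 + yt.2 * f yt).

Lemma ext_mod_ext Y (Q : (Y -> R) -> Prop) f g :
  f =1 g -> ext_mod Q f -> ext_mod Q g.
Proof. by move=> /funext ->. Qed.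

Lemma ext_coeff_field Y (K : (Y -> R) -> Prop) :
  coeff_field K -> coeff_field (ext_coeff K).
Proof.
move=> hK; split.
- by move=> c; exists (fun=> c) => //; exact: coeff_cst.
- move=> _ _ [f Kf ->] [g Kg ->].
  by exists (fun y => f y + g y) => //; exact: coeff_add.
- move=> _ _ [f Kf ->] [g Kg ->].
  by exists (fun y => f y * g y) => //; exact: coeff_mul.
- move=> _ [f Kf ->].
  by exists (fun y => (f y)^-1) => //; exact: coeff_inv.
Qed.

Lemma ext_forms Y (K A : (Y -> R) -> Prop) :
  coeff_field K -> forms K A -> forms (ext_coeff K) (ext_form K A).
Proof.
move=> hK hA; split.
- move=> _ [k Kk ->]; exists k, (fun=> 0); split; first exact: forms_coeff hA _ Kk.
    exact: coeff_cst.
  by apply/funext => y; rewrite /= mul0r addr0.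
- move=> _ _ [a [k [Aa Kk ->]]] [b [l [Ab Kl ->]]].
  exists (fun y => a y + b y), (fun y => k y + l y); split.
  + exact: forms_add hA _ _ _ _.
  + exact: coeff_add.
  + by apply/funext => y /=; ring.
- move=> _ _ [c Kc ->] [a [k [Aa Kk ->]]].
  exists (fun y => c y * a y), (fun y => c y * k y); split.
  + exact: forms_mul hA _ _ _ _.
  + exact: coeff_mul.
  + by apply/funext => y /=; ring.
Qed.

Lemma ext_form_module Y (K A Q : (Y -> R) -> Prop) :
  forms K A -> form_module A Q -> form_module (ext_form K A) (ext_mod Q).
Proof.
move=> hA hQ.
have hadd p q : ext_mod Q p -> ext_mod Q q -> ext_mod Q (fun y => p y + q y).
  move=> Qp; elim: Qp q => [p0 Qp0 q|p0 p1 Qp0 Qp1 IH q].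
  - case=> [q0 Qq0|q0 q1 Qq0 Qq1].
      exact: (ext_mod_cst (q := fun y => p0 y + q0 y) (fmod_add hQ Qp0 Qq0)).
    apply: ext_mod_ext (ext_mod_horner (fmod_add hQ Qp0 Qq0) Qq1) => y /=.
    by rewrite addrA.
  - case=> [q0 Qq0|q0 q1 Qq0 Qq1].
      apply: ext_mod_ext (ext_mod_horner (fmod_add hQ Qp0 Qq0) Qp1) => y /=.
      by ring.
    apply: ext_mod_ext (ext_mod_horner (fmod_add hQ Qp0 Qq0) (IH _ Qq1)) => y /=.
    by ring.
split=> //.
- move=> c; exact: (ext_mod_cst (fmod_cst hQ c)).
- have hmul a p : A a -> ext_mod Q p -> ext_mod Q (fun y => a y.1 * p y).
    move=> Aa; elim=> [q Qq|q f Qq _ IH].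
      exact: (ext_mod_cst (fmod_mul hQ Aa Qq)).
    apply: ext_mod_ext (ext_mod_horner (fmod_mul hQ Aa Qq) IH) => y /=.
    by ring.
  move=> _ q [a [k [Aa Kk ->]]] Qq.
  have h0 := hmul _ _ Aa Qq.
  have h1 := ext_mod_horner (fmod_cst hQ 0) (hmul _ _ (forms_coeff hA Kk) Qq).
  apply: ext_mod_ext (hadd _ _ h0 h1) => y /=.
  by ring.
Qed.

(** The side [s] does not depend on [y], so whether an end is open or closed is known before any
    test is made. *)
Definition bound_form Y (A : (Y -> R) -> Prop) (b : Y -> itv_bound R) :=
  exists s a, A a /\ b = fun y => BSide s (a y).

(** Depending on the two sides, the comparison of bounds means [a <= b] or [a < b]. Both are decided
    by one sign test of a difference; the strict one is the negation of [b <= a], whence the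
    exchanged branches. *)
Lemma tree_if_le Y T (K A : (Y -> R) -> Prop) L (l u : Y -> itv_bound R)
    (f g : Y -> T) : coeff_field K -> forms K A ->
  bound_form A l -> bound_form A u -> tree A L f -> tree A L g ->
  tree A L (fun y => if (l y <= u y)%O then f y else g y).
Proof.
move=> hK hA [s [a [Aa ->]]] [s' [b [Ab ->]]] tf tg.
have hsub c d : A c -> A d -> A (fun y => d y - c y).
  move=> Ac Ad.
  have := forms_add hA Ad (forms_mul hA (coeff_cst hK (-1)) Ac).
  by rewrite (_ : (fun y => _) = (fun y => d y - c y))//; apply/funext=> y; ring.
case: (boolP (s' ==> s)) => ss.
  apply: tree_ext (tree_node (hsub _ _ Aa Ab) tf tg) => y /=.
  by rewrite subr_ge0; case: s s' ss => -[]//= _; rewrite bnd_simp.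
apply: tree_ext (tree_node (hsub _ _ Ab Aa) tg tf) => y /=.
rewrite subr_ge0 leNgt; case: s s' ss => -[]//= _.
by rewrite bnd_simp; case: ltP.
Qed.

Section Fibre.
(** [good] isolates what cutting an interval demands of a function: nothing for existence,
    measurability and local boundedness for integrals. *)
Variables (T S : Type) (op : S -> S -> S) (good : (R -> T) -> Prop).
Variable Phi : itv_bound R -> itv_bound R -> (R -> T) -> S.
Hypothesis Phi_ext : forall l u f g,
  (forall t, t \in Interval l u -> f t = g t) -> Phi l u f = Phi l u g.
Hypothesis Phi_split : forall (s1 s2 s3 : bool) (l r u : R) f, good f ->
  (BSide s1 l <= BSide s2 r)%O -> (BSide s2 r <= BSide s3 u)%O ->
  Phi (BSide s1 l) (BSide s3 u) f =
  op (Phi (BSide s1 l) (BSide s2 r) f) (Phi (BSide s2 r) (BSide s3 u) f).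
Hypothesis good_if : forall a k f g, good f -> good g ->
  good (fun t => if 0 <= a + k * t then f t else g t).
Variables (Y : Type) (K A : (Y -> R) -> Prop).
Hypotheses (hK : coeff_field K) (hA : forms K A).
Variables (L : (Y * R -> T) -> Prop) (L' : (Y -> S) -> Prop).
Hypothesis good_leaf : forall f y, L f -> good (fun t => f (y, t)).
Hypothesis op_leaf : forall f g, L' f -> L' g -> L' (fun y => op (f y) (g y)).
Hypothesis Phi_leaf : forall f l u, L f -> bound_form A l -> bound_form A u ->
  tree A L' (fun y => Phi (l y) (u y) (fun t => f (y, t))).

Lemma tree_good f y : tree (ext_form K A) L f -> good (fun t => f (y, t)).
Proof.
elim=> [{}f Lf|a f1 f2]; first exact: good_leaf.
move=> [b [k [_ _ ->]]] _ g1 _ g2 /=; exact: good_if.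
Qed.

(* [Phi l u] stands for either "exists t in the interval" or the integral over it.  A test
   [0 <= a + k t] at the root of the tree cuts the interval at [- a / k]. *)
Lemma tree_fibre f : tree (ext_form K A) L f ->
  forall l u, bound_form A l -> bound_form A u ->
  tree A L' (fun y => Phi (l y) (u y) (fun t => f (y, t))).
Proof.
elim=> [g Lg l u hl hu|a' f1 f2 Aa' tf1 IH1 tf2 IH2 l u hl hu].
  exact: Phi_leaf.
have gd y := tree_good y (tree_node Aa' tf1 tf2).
case: Aa' gd => a [k [Aa Kk ->]] gd.
(* Where [k y = 0] this is a meaningless total value; it is consulted only in the branches with
   [k y] nonzero. *)
pose r y := - a y / k y.
have Ar : A r.
  have := forms_mul hA (coeff_mul hK (coeff_cst hK (-1)) (coeff_inv hK Kk)) Aa.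
  by rewrite (_ : (fun y => _) = r)//; apply/funext=> y; rewrite /r; ring.
have hbl s : bound_form A (fun y => BSide s (r y)) by exists s, r.
have Ak := forms_coeff hA Kk.
have ANk := forms_mul hA (coeff_cst hK (-1)) Ak.
have top2 g1 g2 : tree A L' g1 -> tree A L' g2 ->
    tree A L' (fun y => op (g1 y) (g2 y)).
  by apply: tree_op2 => l1 l2; exact: op_leaf.
(* For [k > 0] the test holds exactly for [t >= r], so the cut is just left of [r]; for [k < 0] it
   holds exactly for [t <= r], and the cut is just right of [r]. The root thus stays in the piece
   where the test succeeds. Two comparisons of bounds settle a root outside the interval. *)
have tpos := tree_if_le hK hA (hbl true) hl (IH1 _ _ hl hu)
  (tree_if_le hK hA hu (hbl true) (IH2 _ _ hl hu)
    (top2 _ _ (IH2 _ _ hl (hbl true)) (IH1 _ _ (hbl true) hu))).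
have tneg := tree_if_le hK hA (hbl false) hl (IH2 _ _ hl hu)
  (tree_if_le hK hA hu (hbl false) (IH1 _ _ hl hu)
    (top2 _ _ (IH1 _ _ hl (hbl false)) (IH2 _ _ (hbl false) hu))).
have tzero := tree_node Aa (IH1 _ _ hl hu) (IH2 _ _ hl hu).
(* The sign of [k] is itself read off from two weak tests; for [k = 0] the sign of [a] decides for
   all [t] at once. *)
apply: tree_ext (tree_node Ak (tree_node ANk tzero tpos) tneg) => y /=.
rewrite mulN1r oppr_ge0.
have [s1 [b1 [_ El]]] := hl; have [s3 [b3 [_ Eu]]] := hu.
have {}El : l y = BSide s1 (b1 y) by rewrite El.
have {}Eu : u y = BSide s3 (b3 y) by rewrite Eu.
have [k0|k0|k0] := ltgtP 0 (k y).
- have E t : (0 <= a y + k y * t) = (BLeft (r y) <= BLeft t)%O.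
    by rewrite bnd_simp /r ler_pdivrMr// -[RHS]subr_ge0; congr (_ <= _); ring.
  have [rl|rl] := leP (BLeft (r y)) (l y).
    apply: Phi_ext => t; rewrite itv_boundlr => /andP[lt _].
    by rewrite E (le_trans rl).
  have [ur|ur] := leP (u y) (BLeft (r y)).
    apply: Phi_ext => t; rewrite itv_boundlr => /andP[_ tu].
    by rewrite E leNgt (lt_le_trans _ ur)// (lt_le_trans _ tu)// bnd_simp.
  rewrite [RHS](_ : _ = Phi (BSide s1 (b1 y)) (BSide s3 (b3 y)) (fun t =>
    if 0 <= a y + k y * t then f1 (y, t) else f2 (y, t))) ?El ?Eu//.
  rewrite (Phi_split (s2 := true) (r := r y) (gd y)) -?El -?Eu ?ltW//.
  congr op; apply: Phi_ext => t; rewrite itv_boundlr => /andP[lt tu].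
    by rewrite E leNgt (lt_le_trans _ tu)// bnd_simp.
  by rewrite E lt.
- have E t : (0 <= a y + k y * t) = (BRight t <= BRight (r y))%O.
    by rewrite bnd_simp /r ler_ndivlMr// -[RHS]subr_ge0; congr (_ <= _); ring.
  have [rl|rl] := leP (BRight (r y)) (l y).
    apply: Phi_ext => t; rewrite itv_boundlr => /andP[lt _].
    by rewrite E leNgt (le_lt_trans rl)// (le_lt_trans lt)// bnd_simp.
  have [ur|ur] := leP (u y) (BRight (r y)).
    apply: Phi_ext => t; rewrite itv_boundlr => /andP[_ tu].
    by rewrite E (le_trans tu ur).
  rewrite [RHS](_ : _ = Phi (BSide s1 (b1 y)) (BSide s3 (b3 y)) (fun t =>
    if 0 <= a y + k y * t then f1 (y, t) else f2 (y, t))) ?El ?Eu//.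
  rewrite (Phi_split (s2 := false) (r := r y) (gd y)) -?El -?Eu ?ltW//.
  congr op; apply: Phi_ext => t; rewrite itv_boundlr => /andP[lt tu].
    by rewrite E tu.
  by rewrite E leNgt (le_lt_trans lt)// bnd_simp.
- rewrite -k0; case: ifP => a0; apply: Phi_ext => t _ /=.
    by rewrite mul0r addr0 a0.
  by rewrite mul0r addr0 a0.
Qed.

End Fibre.
End Trees.

(** * Eliminating and integrating one variable *)

Section Elim.
Variable R : realType.
Local Notation mu := (@lebesgue_measure R).

Lemma itv_inhabited (s1 s2 : bool) (a b : R) :
  (BSide s1 a < BSide s2 b)%O ->
  exists t, t \in Interval (BSide s1 a) (BSide s2 b).
Proof.
move=> ab.
have ab' : a <= b by case: s1 s2 ab => -[]; rewrite bnd_simp// => /ltW.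
case: s1 ab => ab.
  exists a; rewrite itv_boundlr lexx /=.
  by case: s2 ab; rewrite !bnd_simp.
case: s2 ab => ab; last by exists b; rewrite itv_boundlr lexx; move: ab; rewrite !bnd_simp => ->.
exists ((a + b) / 2); move: ab; rewrite in_itv/= bnd_simp => ab.
by apply/andP; split; lra.
Qed.

Lemma tree_exists Y (K A : (Y -> R) -> Prop) (f : Y * R -> bool) l u :
  coeff_field K -> forms K A -> bound_form A l -> bound_form A u ->
  tree (ext_form K A) (@is_const _ _) f ->
  tree A (@is_const _ _)
    (fun y => `[< exists2 t, t \in Interval (l y) (u y) & f (y, t) >]).
Proof.
move=> hK hA hl hu tf.
pose Phi (l u : itv_bound R) (g : R -> bool) :=
  `[< exists2 t, t \in Interval l u & g t >].
apply: (tree_fibre (op := orb) (good := fun=> True) (Phi := Phi) _ _ _ hK hA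
  _ _ _ tf hl hu) => //.
- move=> l0 u0 g1 g2 eg; apply/asbool_equiv_eq; split=> -[t ti gt].
    by exists t => //; rewrite -eg.
  by exists t => //; rewrite eg.
- move=> s1 s2 s3 a b c g _ ab bc; rewrite /Phi -asbool_or.
  have E t : t \in Interval (BSide s1 a) (BSide s3 c) <->
      (t \in Interval (BSide s1 a) (BSide s2 b)) \/
      (t \in Interval (BSide s2 b) (BSide s3 c)).
    have /seteqP[h1 h2] := itv_bndbnd_setU ab bc.
    by split; [exact: h1|exact: h2].
  apply/asbool_equiv_eq; split.
    by move=> [t /E[] ti gt]; [left|right]; exists t.
  by move=> [] [t ti gt]; exists t => //; apply/E; [left|right].
- by move=> _ _ [b1 ->] [b2 ->]; exists (b1 || b2).
- move=> g l0 u0 [b ->] hl0 hu0.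
  have tcst c : tree A (@is_const Y bool) (fun=> c).
    by apply: tree_leaf; exists c.
  (* The bounds are compared in reverse so that [b] is returned only for [l y < u y]: equal bounds
     enclose no point. *)
  apply: tree_ext (tree_if_le hK hA hu0 hl0 (tcst false) (tcst b)) => y /=.
  case: leP => [ul|lu].
    apply/esym/asboolPn => -[t]; rewrite itv_boundlr => /andP[lt tu] _.
    by have := le_trans tu (le_trans ul lt); rewrite bnd_simp ltxx.
  have [s1 [a1 [_ El]]] := hl0; have [s2 [a2 [_ Eu]]] := hu0.
  case: b; last by apply/esym/asboolPn => -[].
  apply/esym/asboolP; move: lu; rewrite El Eu => /itv_inhabited[t tI].
  by exists t.
Qed.

(** Implies integrability on every bounded interval and, unlike integrability, is stable under
    products. *)
Definition locally_bounded_measurable (f : R -> R) :=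
  measurable_fun setT f /\ forall M, exists C, forall t, `|t| <= M -> `|f t| <= C.

Lemma lbm_integrable f (s1 s2 : bool) (a b : R) :
  locally_bounded_measurable f ->
  mu.-integrable [set` Interval (BSide s1 a) (BSide s2 b)] (EFin \o f).
Proof.
move=> [mf bf]; apply: measurable_bounded_integrable => //.
- rewrite (le_lt_trans (y := mu `[a, b]))//.
    apply: le_measure; rewrite ?inE//.
    by apply: subitvP; rewrite subitvE; case: s1 s2 => -[]; rewrite ?bnd_simp//.
  by rewrite /= lebesgue_measure_itv/=; case: ifP => // _; rewrite -EFinB ltry.
- exact: measurable_funTS.
- have [C hC] := bf (Num.max `|a| `|b|).
  exists C; split; first exact: num_real.
  move=> x Cx t /= tI; apply: (le_trans (hC t _) (ltW Cx)).
  have : t \in `[a, b].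
    by apply: subitvP tI; rewrite subitvE; case: s1 s2 => -[]; rewrite ?bnd_simp.
  rewrite in_itv/= => /andP[a1 b1]; rewrite le_max.
  have [t0|t0] := leP 0 t.
    by apply/orP; right; rewrite ger0_norm// (le_trans b1)// ler_norm.
  by rewrite ltr0_norm//; apply/orP; left; rewrite ler_normr lerN2 a1 orbT.
Qed.

Lemma lbm_cst c : locally_bounded_measurable (fun=> c).
Proof. by split; [exact: measurable_cst|exists `|c|]. Qed.

Lemma lbm_id : locally_bounded_measurable id.
Proof. by split; [exact: measurable_id|move=> M; exists M]. Qed.

Lemma lbmD f g : locally_bounded_measurable f -> locally_bounded_measurable g ->
  locally_bounded_measurable (fun t => f t + g t).
Proof.
move=> [mf bf] [mg bg]; split; first exact: measurable_funD.
move=> M; have [C hC] := bf M; have [D hD] := bg M; exists (C + D) => t tM.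
by rewrite (le_trans (ler_normD _ _))// lerD ?hC ?hD.
Qed.

Lemma lbmM f g : locally_bounded_measurable f -> locally_bounded_measurable g ->
  locally_bounded_measurable (fun t => f t * g t).
Proof.
move=> [mf bf] [mg bg]; split; first exact: measurable_funM.
move=> M; have [C hC] := bf M; have [D hD] := bg M; exists (C * D) => t tM.
by rewrite normrM ler_pM ?hC ?hD.
Qed.

Lemma lbmX n : locally_bounded_measurable (fun t => t ^+ n).
Proof.
elim: n => [|n IH]; first exact: lbm_cst.
under [X in locally_bounded_measurable X]funext do rewrite exprS.
exact: lbmM lbm_id IH.
Qed.

Lemma lbm_if a k f g :
  locally_bounded_measurable f -> locally_bounded_measurable g ->
  locally_bounded_measurable (fun t => if 0 <= a + k * t then f t else g t).
Proof.
move=> [mf bf] [mg bg]; split.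
  apply: measurable_fun_ifT => //; apply: measurable_fun_ler => //.
  exact: (lbmD (lbm_cst a) (lbmM (lbm_cst k) lbm_id)).1.
move=> M; have [C hC] := bf M; have [D hD] := bg M; exists (Num.max C D) => t tM.
by case: ifP => _; rewrite le_max ?hC ?hD ?orbT.
Qed.

(** The fundamental theorem of calculus on the closed interval; end points have measure zero, so the
    sides do not matter. The case [a = b] is separate because that theorem is applied for
    [a < b]. *)
Lemma Rintegral_exprn n (s1 s2 : bool) (a b : R) : a <= b ->
  \int[mu]_(t in [set` Interval (BSide s1 a) (BSide s2 b)]) (t ^+ n) =
  (b ^+ n.+1 - a ^+ n.+1) / n.+1%:R.
Proof.
rewrite le_eqVlt => /predU1P[->|ab].
  by rewrite subrr mul0r; case: s1 s2 => -[]; rewrite set_itvE ?Rintegral_set0 ?Rintegral_set1.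
have cX m (x : R) : {for x, continuous (fun t : R => t ^+ m)} by exact: exprn_continuous.
pose F := fun x : R => x ^+ n.+1 / n.+1%:R.
have cF x : {for x, continuous F}.
  by apply: cvgMl; exact: cX.
have dF (x : R) : is_derive x 1 F (x ^+ n).
  have h : is_derive x 1 (fun t : R => t ^+ n.+1) (n.+1%:R * x ^+ n).
    apply: DeriveDef; first exact: exprn_derivable.
    by rewrite exp_derive [LHS]mulr1.
  rewrite (_ : F = n.+1%:R^-1 \*: (fun t : R => t ^+ n.+1)); last first.
    by apply/funext => t; rewrite /F mulrC.
  apply: is_derive_eq.
  by rewrite /GRing.scale/= mulrA mulVf ?mul1r// pnatr_eq0.
have mX : measurable_fun `]a, b[%classic (fun t : R => (t ^+ n)%:E).
  by apply/measurable_EFinP/measurable_funTS; exact: (lbmX n).1.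
rewrite /Rintegral integral_itv_bndoo// -(integral_itv_bndoo true false)//.
rewrite (continuous_FTC2 (F := F))//.
- by rewrite /F -EFinB /= mulrBl.
- by apply: continuous_subspaceT => x; exact: cX.
- split.
  + by move=> x _; case: (dF x).
  + by apply: cvg_at_right_filter; exact: cF.
  + by apply: cvg_at_left_filter; exact: cF.
- by move=> x _; rewrite derive1E; case: (dF x).
Qed.

End Elim.

(** * Integrals of decision trees and volumes of bounded fibres *)

Section Integration.
Variable R : realType.
Local Notation mu := (@lebesgue_measure R).

Lemma lbm_ext_mod Y (Q : (Y -> R) -> Prop) f y :
  ext_mod Q f -> locally_bounded_measurable (fun t => f (y, t)).
Proof.
elim=> [q _|q g _ _ IH]; first exact: (lbm_cst (q y)).
exact: (lbmD (lbm_cst (q y)) (lbmM (@lbm_id R) IH)).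
Qed.

(** The factor [t ^+ j] makes the induction on the Horner form work: the [t] in [q + t * f] is
    absorbed by the induction hypothesis at [j.+1]. The result is polynomial in the end points [a]
    and [b], which are forms. *)
Lemma integral_ext_mod Y (K A Q : (Y -> R) -> Prop) (s1 s2 : bool) a b f j :
  coeff_field K -> forms K A -> form_module A Q -> A a -> A b ->
  ext_mod Q f ->
  exists2 F, Q F & forall y, a y <= b y ->
    \int[mu]_(t in [set` Interval (BSide s1 (a y)) (BSide s2 (b y))])
      (t ^+ j * f (y, t)) = F y.
Proof.
move=> hK hA hQ Aa Ab Qf.
have QX c q k : A c -> Q q -> Q (fun y => c y ^+ k * q y).
  move=> Ac Qq; elim: k => [|k IH].
    by under [X in Q X]funext do rewrite expr0 mul1r.
  under [X in Q X]funext do rewrite exprS -mulrA.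
  exact: fmod_mul hQ _ _ _ _.
have QZ c q : Q q -> Q (fun y => c * q y).
  by move=> Qq; exact: (fmod_mul hQ (forms_coeff hA (coeff_cst hK c)) Qq).
have Qmon q k : Q q -> Q (fun y => (b y ^+ k - a y ^+ k) / k%:R * q y).
  move=> Qq.
  rewrite (_ : (fun y => _) = fun y => k%:R^-1 * (b y ^+ k * q y + (-1) * (a y ^+ k * q y))).
    by apply: (QZ); apply: (fmod_add hQ); [|apply: (QZ)]; apply: QX.
  by apply/funext => y; ring.
have mon q k y : a y <= b y ->
    \int[mu]_(t in [set` Interval (BSide s1 (a y)) (BSide s2 (b y))])
      (t ^+ k * q) = (b y ^+ k.+1 - a y ^+ k.+1) / k.+1%:R * q.
  move=> ab; rewrite RintegralZr//; last by apply: lbm_integrable; exact: lbmX.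
  by rewrite Rintegral_exprn.
elim: Qf j => [q Qq j|q g Qq Qg IH j].
  by apply: ex_intro2 (Qmon q j.+1 Qq) _ => y ab /=; rewrite mon.
have [F QF hF] := IH j.+1.
apply: ex_intro2 (fmod_add hQ (Qmon q j.+1 Qq) QF) _ => y ab /=; rewrite -mon// -hF// -RintegralD//.
- by apply: eq_Rintegral => t _ /=; rewrite exprSr; ring.
- by apply: lbm_integrable; apply: lbmM; [exact: lbmX|exact: lbm_cst].
- apply: lbm_integrable; apply: lbmM; first exact: lbmX.
  exact: lbm_ext_mod Qg.
Qed.

Lemma tree_integral Y (K A Q : (Y -> R) -> Prop) f l u :
  coeff_field K -> forms K A -> form_module A Q ->
  bound_form A l -> bound_form A u ->
  tree (ext_form K A) (ext_mod Q) f ->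
  tree A Q (fun y => \int[mu]_(t in [set` Interval (l y) (u y)]) f (y, t)).
Proof.
move=> hK hA hQ hl hu tf.
pose Phi (l u : itv_bound R) (g : R -> R) :=
  \int[mu]_(t in [set` Interval l u]) g t.
apply: (tree_fibre (op := +%R) (good := @locally_bounded_measurable R)
  (Phi := Phi) _ _ (@lbm_if R) hK hA _ (fmod_add hQ) _ tf hl hu).
- by move=> l0 u0 g1 g2 eg; apply: eq_Rintegral => t; rewrite inE => /eg.
- move=> s1 s2 s3 a b c g hg ab bc; rewrite /Phi (itv_bndbnd_setU ab bc).
  rewrite Rintegral_setU//.
    by rewrite -itv_bndbnd_setU//; exact: lbm_integrable.
  apply/disj_setPS => t [/=]; rewrite !itv_boundlr => /andP[_ tb] /andP[bt _].
  by have := le_trans tb bt; rewrite bnd_simp ltxx.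
- by move=> g y; exact: lbm_ext_mod.
- move=> g l0 u0 Qg hl0 hu0.
  have [s1 [a [Aa El]]] := hl0; have [s2 [b [Ab Eu]]] := hu0.
  have [F QF hF] := integral_ext_mod s1 s2 0 hK hA hQ Aa Ab Qg.
  (* The formula [F] is valid for ordered end points only; otherwise the interval is empty and the
     integral is 0. *)
  apply: tree_ext (tree_if_le hK hA hl0 hu0 (tree_leaf A QF)
    (tree_leaf A (fmod_cst hQ 0))) => y /=.
  rewrite /Phi; case: ifP => lu; last first.
    by rewrite set_itv_ge ?Rintegral_set0 //; apply: contraFN lu => /ltW.
  rewrite El Eu -hF; first by apply: eq_Rintegral => t _; rewrite expr0 mul1r.
  by move: lu; rewrite El Eu; case: s1 s2 {El Eu hF} => -[]; rewrite bnd_simp// => /ltW.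
Qed.

(** The constant term may involve the coordinates already moved into [Y], the coefficients of the
    remaining ones may not. Roots of tests therefore stay affine. *)
Definition lin_form Y (A K : (Y -> R) -> Prop) n (g : Y * 'rV[R]_n -> R) : Prop :=
  exists a (k : Y -> 'cV[R]_n), [/\ A a, forall j, K (fun y => k y j 0) &
    g = fun yz => a yz.1 + (yz.2 *m k yz.1) 0 0].

Definition section_map Y n (w : (Y * R) * 'rV[R]_n) : Y * 'rV[R]_n.+1 :=
  (w.1.1, row_mx (const_mx w.1.2 : 'rV[R]_1) w.2).

Lemma mul_row_cV_00 n (t : 'rV[R]_1) (v : 'rV[R]_n) (k : 'cV[R]_(1 + n)) :
  (row_mx t v *m k) 0 0 = t 0 0 * k 0 0 + (v *m dsubmx k) 0 0.
Proof.
rewrite -[k in LHS]vsubmxK mul_row_col mxE; congr (_ + _).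
by rewrite mxE big_ord1 mxE; congr (_ * k _ _); exact/val_inj.
Qed.

Lemma lin_form_section Y (A K : (Y -> R) -> Prop) n (g : Y * 'rV[R]_n.+1 -> R) :
  lin_form A K g ->
  lin_form (ext_form K A) (ext_coeff K) (g \o @section_map Y n).
Proof.
move=> [a [k [Aa Kk ->]]].
exists (fun yt => a yt.1 + k yt.1 0 0 * yt.2).
exists (fun yt => dsubmx (k yt.1 : 'cV[R]_(1 + n))); split.
- by exists a, (fun y => k y 0 0).
- move=> j; exists (fun y => k y (rshift 1 j) 0); first exact: Kk.
  by apply/funext => yt /=; rewrite mxE.
- apply/funext => -[[y t] v] /=.
  rewrite -addrA; congr (_ + _).
  by rewrite [LHS](mul_row_cV_00 _ _ (k y)) mxE mulrC.
Qed.

Lemma vol_set0 n : vol (set0 : set 'rV[R]_n) = 0%E.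
Proof.
elim: n => [|n IH] /=; first by case: asboolP.
by rewrite integral0_eq.
Qed.

Lemma vol_tree n : forall Y (K A Q : (Y -> R) -> Prop) M
    (f : Y * 'rV[R]_n -> bool),
  coeff_field K -> forms K A -> form_module A Q -> K M ->
  tree (@lin_form _ A K n) (@is_const _ _) f ->
  (forall y z, f (y, z) -> forall j, `|z 0 j| <= M y) ->
  exists2 V, tree A Q V & forall y, vol [set z | f (y, z)] = (V y)%:E.
Proof.
elim: n => [|n IH] Y K A Q M f hK hA hQ KM tf bf.
  exists (fun y => if f (y, 0) then 1 else 0); last first.
    move=> y /=; case: asboolP => /= [->//|/negP/negbTE->//].
  apply: (tree_bind (h := fun y => (y, 0)) (phi := fun _ (b : bool) => if b then 1 else 0) _ _ tf).
    move=> _ [a [k [Aa _ ->]]] /=.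
    suff -> : (fun yz : Y * 'rV[R]_0 => a yz.1 + (yz.2 *m k yz.1) 0 0) \o (fun y => (y, 0)) = a by [].
    apply/funext => y /=.
    by rewrite mul0mx mxE addr0.
  by move=> _ [b ->]; apply: tree_leaf; exact: (fmod_cst hQ (if b then 1 else 0)).
have tf' : tree (@lin_form _ (ext_form K A) (ext_coeff K) n) (@is_const _ _)
    (f \o @section_map Y n).
  apply: tree_pull tf; first exact: lin_form_section.
  by move=> _ [c ->]; exists c.
have [||V tV hV] := IH _ _ _ _ (M \o fst) _ (ext_coeff_field hK)
    (ext_forms hK hA) (ext_form_module hA hQ) _ tf'.
- by exists M.
- move=> [y t] z /= /bf h j; have := h (rshift 1 j).
  by rewrite (@row_mxEr _ 1 1 n).
have hNM : A (fun y => -1 * M y).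
  exact: forms_mul hA _ _ (coeff_cst hK _) (forms_coeff hA KM).
have hl : bound_form A (fun y => BLeft (- M y)).
  exists true, (fun y => -1 * M y); split=> //.
  by apply/funext => y; rewrite mulN1r.
have hu : bound_form A (fun y => BRight (M y)).
  by exists false, M; split=> //; exact: forms_coeff hA _ KM.
apply: ex_intro2 (tree_integral hK hA hQ hl hu tV) _ => y /=.
have V0 t : ~ `[- M y, M y]%classic t -> V (y, t) = 0.
  move=> tM; apply: EFin_inj; rewrite -hV (_ : mkset _ = set0) ?vol_set0//.
  apply/seteqP; split=> // v /= /bf /(_ (lshift n (ord0 : 'I_1))).
  by rewrite (@row_mxEl _ 1 1 n) mxE ler_norml => ?; exact: tM.
rewrite /Rintegral fineK; last first.
  apply: integrable_fin_num => //.
  apply: lbm_integrable; apply: tree_good tV.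
  - exact: lbm_if.
  - by move=> g z; exact: lbm_ext_mod.
rewrite [RHS]integral_mkcond; apply: eq_integral => t _ /=.
rewrite patchE; case: ifPn => [_|]; first by rewrite -hV.
by rewrite notin_setE => /V0 h; rewrite -[LHS]/(vol [set v | f (@section_map Y n ((y, t), v))]) hV h.
Qed.

End Integration.

(** * Linear change of variables *)

Section ChangeOfVariables.
Variable R : realType.
Local Notation mu := (@lebesgue_measure R).

Lemma vol_ge0 n (A : set 'rV[R]_n) : (0 <= vol A)%E.
Proof.
elim: n A => [|n IH] A /=; first by case: asboolP.
by apply: integral_ge0 => t _; exact: IH.
Qed.

Definition mfun d (T : measurableType d) (a : T -> R) := measurable_fun setT a.

(** The same induction as for [vol_tree], now without a bound on the fibres: coefficients are merely
    measurable, and Tonelli gives measurability of the integral over the coordinate split off. This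
    justifies the later substitutions and exchanges of integrals. *)
Lemma measurable_vol n d (T : measurableType d) (f : T * 'rV[R]_n -> bool) :
  tree (lin_form (@mfun d T) (@mfun d T) (n:=n)) (@is_const _ _) f ->
  measurable_fun setT (fun y => vol [set z | f (y, z)]).
Proof.
elim: n d T f => [|n IH] d T f tf.
  have mf : measurable_fun setT (fun y => f (y, 0)).
    elim: tf => [_ [b ->]|_ g h [a [k [ma mk ->]]] _ IHg _ IHh] /=.
      exact: measurable_cst.
    apply: measurable_fun_ifT => //; apply: measurable_fun_ler => //.
    rewrite (_ : (fun y => _) = a)//; apply/funext => y.
    by rewrite mul0mx mxE addr0.
  rewrite [X in measurable_fun _ X](_ : _ =
      fun y => if f (y, 0) then 1%E else 0%E).
    by apply: measurable_fun_ifT.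
  by apply/funext => y /=; case: asboolP => [->//|/negP/negbTE->].
have tf' : tree (lin_form (@mfun _ (T * R)%type) (@mfun _ (T * R)%type) (n:=n))
    (@is_const _ _) (f \o @section_map _ _ n).
  apply: tree_pull tf; last by move=> _ [b ->]; exists b.
  move=> g /lin_form_section[_ [k [[a [l [ma ml ->]]] mk ->]]].
  have mfst h : mfun h -> mfun (fun y : T * R => h y.1).
    by move=> mh; exact: measurableT_comp mh _.
  exists (fun yt => a yt.1 + l yt.1 * yt.2), k; split=> //.
    by apply: measurable_funD; [|apply: measurable_funM]; [exact: mfst|exact: mfst|].
  by move=> j; have [c mc ->] := mk j; exact: mfst.
have mV := IH _ _ _ tf'.
exact: (measurable_fun_fubini_tonelli_F (m2 := mu) _ mV (fun y => vol_ge0 _)).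
Qed.

Definition affine n (g : 'rV[R]_n -> R) :=
  exists c (k : 'cV[R]_n), g = fun z => c + (z *m k) 0 0.

(** Indicators of finite Boolean combinations of half-spaces, possibly neither convex nor
    bounded. *)
Definition polyhedral n (f : 'rV[R]_n -> bool) :=
  tree (@affine n) (@is_const _ _) f.

Lemma polyhedral_affine m n (M : 'M[R]_(m, n)) w f :
  polyhedral f -> polyhedral (fun z => f (z *m M + w)).
Proof.
apply: (tree_pull (h := fun z => z *m M + w)); last by move=> _ [b ->]; exists b.
move=> _ [c [k ->]]; exists (c + (w *m k) 0 0), (M *m k).
by apply/funext => z /=; rewrite mulmxDl mulmxA mxE addrAC addrA.
Qed.

Lemma polyhedral_section n (f : 'rV[R]_(1 + n) -> bool) t :
  polyhedral f -> polyhedral (fun v => f (row_mx t v)).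
Proof.
move=> /(polyhedral_affine (row_mx 0 1%:M : 'M[R]_(n, 1 + n)) (row_mx t 0)).
apply: tree_ext => v.
by rewrite mul_mx_row mulmx0 mulmx1 add_row_mx add0r addr0.
Qed.

Lemma measurable_vol_section n (f : 'rV[R]_(1 + n) -> bool) :
  polyhedral f ->
  measurable_fun setT (fun t : R => vol [set v | f (row_mx (const_mx t) v)]).
Proof.
move=> pf.
apply: (measurable_vol (f := fun w => f (row_mx (const_mx w.1) w.2))).
apply: (tree_pull (h := fun w => row_mx (const_mx w.1) w.2)) pf.
  move=> _ [c [k ->]].
  exists (fun t => c + t * k 0 0), (fun=> dsubmx k); split.
  - apply: measurable_funD; first exact: measurable_cst.
    by apply: measurable_funM; first exact: measurable_id.
  - by move=> j; exact: measurable_cst.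
  - by apply/funext => -[t v] /=; rewrite mul_row_cV_00 mxE addrA.
by move=> _ [b ->]; exists b.
Qed.

Lemma measurable_vol_section2 n (f : 'rV[R]_(1 + (1 + n)) -> bool) :
  polyhedral f ->
  measurable_fun setT (fun st : R * R =>
    vol [set v | f (row_mx (const_mx st.1) (row_mx (const_mx st.2) v))]).
Proof.
move=> pf.
pose h (w : R * R * 'rV[R]_n) : 'rV[R]_(1 + (1 + n)) :=
  row_mx (const_mx w.1.1) (row_mx (const_mx w.1.2) w.2).
apply: (measurable_vol (f := f \o h)).
apply: (tree_pull (h := h)) pf.
  move=> _ [c [k ->]].
  exists (fun t => c + t.1 * k 0 0 + t.2 * dsubmx k 0 0), (fun=> dsubmx (dsubmx k)).
  split.
  - apply: measurable_funD; [apply: measurable_funD|]; first exact: measurable_cst.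
      by apply: measurable_funM; first exact: measurable_fst.
    by apply: measurable_funM; first exact: measurable_snd.
  - by move=> j; exact: measurable_cst.
  - by apply/funext => -[[s t] v] /=; rewrite !mul_row_cV_00 !mxE !addrA.
by move=> _ [b ->]; exists b.
Qed.

(** Lebesgue measure equals [|a|] times its image under [t * a + b], by uniqueness from its values
    on half-open intervals. For [a < 0] the preimage is half-open on the other side but has the same
    length. *)
Lemma ge0_integral_affine (f : R -> \bar R) (a b : R) : a != 0 ->
  measurable_fun setT f -> (forall t, 0 <= f t)%E ->
  (\int[mu]_t f (t * a + b)%R = (`|a|^-1)%:E * \int[mu]_t f t)%E.
Proof.
move=> a0 mf f0.
pose phi : R -> measurableTypeR R := fun t => t * a + b.
have mphi : measurable_fun setT phi.
  by apply: measurable_funD; [apply: measurable_funM|].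
have na0 : 0 < `|a| by rewrite normr_gt0.
have E A : measurable A ->
    mu A = mscale (NngNum (ltW na0)) (pushforward mu phi) A.
  apply: lebesgue_measure_unique => _ [[x y] _ <-].
  change (mu `]x, y]%classic = (`|a|%:E * mu (phi @^-1` `]x, y]%classic))%E).
  have [a_gt0|a_le0] := ltP 0 a.
    rewrite (_ : phi @^-1` _ = `](x - b) / a, (y - b) / a]%classic).
      rewrite !lebesgue_measure_itv/= !lte_fin ltr_pM2r ?invr_gt0// ltrD2r.
      case: ifP => _; last by rewrite mule0.
      by rewrite -!EFinB -EFinM gtr0_norm//; congr (_%:E); field.
    apply/seteqP; split=> t /=; rewrite /phi !in_itv/=.
      by rewrite ltr_pdivrMr// ler_pdivlMr// ltrBlDr lerBrDr.
    by rewrite ltr_pdivrMr// ler_pdivlMr// ltrBlDr lerBrDr.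
  have a_lt0 : a < 0 by rewrite lt_neqAle a0.
  rewrite (_ : phi @^-1` _ = `[(y - b) / a, (x - b) / a[%classic).
    rewrite !lebesgue_measure_itv/= !lte_fin ltr_nM2r ?invr_lt0// ltrD2r.
    case: ifP => _; last by rewrite mule0.
    by rewrite -!EFinB -EFinM ltr0_norm//; congr (_%:E); field.
  apply/seteqP; split=> t /=; rewrite /phi !in_itv/=.
    by rewrite ltr_ndivlMr// ler_ndivrMr// ltrBlDr lerBrDr andbC.
  by rewrite ltr_ndivlMr// ler_ndivrMr// ltrBlDr lerBrDr andbC.
rewrite [X in (_ * X)%E](eq_measure_integral
  (mscale (NngNum (ltW na0)) (pushforward mu phi))); last first.
  by move=> A mA _; exact: E.
rewrite ge0_integral_mscale//= muleA -EFinM mulVf ?gt_eqF// mul1e.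
by rewrite ge0_integral_pushforward.
Qed.

(** The translation [w] is needed for the induction on the dimension: a block triangular matrix
    shifts the section at [t] by an amount depending on [t]. *)
Definition linear_change n (M : 'M[R]_n) := forall (f : 'rV[R]_n -> bool) w,
  polyhedral f ->
  vol [set z | f (z *m M + w)] = ((`|\det M|^-1)%:E * vol [set z | f z])%E.

Lemma linear_change_mul n (M N : 'M[R]_n) :
  linear_change M -> linear_change N -> linear_change (M *m N).
Proof.
move=> hM hN f w pf.
have := hM _ 0 (polyhedral_affine N w pf).
rewrite hN// muleA -EFinM det_mulmx normrM invfM => <-.
by congr vol; apply/seteqP; split => z /=; rewrite addr0 mulmxA.
Qed.

(** On the section at [t] the map acts as [N] followed by a translation, which contributes the
    factor of [N]; the first coordinate undergoes an affine substitution, which contributes that of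
    [a]. *)
Lemma linear_change_block n (a : 'M[R]_1) (r : 'rV[R]_n) (N : 'M[R]_n) :
  \det a != 0 -> linear_change N ->
  linear_change (block_mx a r 0 N : 'M[R]_(1 + n)).
Proof.
rewrite det_mx11 => a0 hN f w pf.
pose V t := vol [set v | f (row_mx (const_mx t) v)].
have mV : measurable_fun setT V by exact: measurable_vol_section.
transitivity (\int[mu]_t ((`|\det N|^-1)%:E * V (t * a 0 0 + w 0 0)%R))%E.
  rewrite [LHS]/=; apply: eq_integral => t _.
  rewrite -(hN _ ((const_mx t : 'rV[R]_1) *m r + @rsubmx R 1 1 n w)); last exact: polyhedral_section.
  congr vol; apply/seteqP.
  suff E v : row_mx (const_mx t) v *m block_mx a r 0 N + w =
      row_mx (const_mx (t * a 0 0 + w 0 0)) (v *m N + ((const_mx t : 'rV[R]_1) *m r + @rsubmx R 1 1 n w)).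
    by split => v /=; rewrite E; exact.
  rewrite (mul_row_block (const_mx t : 'rV[R]_1)) mulmx0 addr0.
  rewrite -[w in LHS](@hsubmxK R 1 1 n) add_row_mx; congr row_mx.
    apply/rowP => j; rewrite !mxE big_ord1 !mxE !ord1; congr (_ + w _ _).
    exact/val_inj.
  by rewrite addrA [v *m N + _]addrC.
have mphi : measurable_fun setT (fun t : R => t * a 0 0 + w 0 0).
  by apply: measurable_funD; [apply: measurable_funM|].
rewrite ge0_integralZl//; last 2 first.
- exact: (measurableT_comp mV mphi).
- by move=> t _; exact: vol_ge0.
rewrite ge0_integral_affine//; last by move=> t; exact: vol_ge0.
rewrite muleA -EFinM; congr (_%:E * _)%E.
by rewrite (@det_ublock R 1) det_mx11 normrM invfM mulrC.
Qed.

Definition swap_mx n : 'M[R]_(1 + (1 + n)) :=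
  block_mx 0 (row_mx 1%:M 0) (col_mx 1%:M 0) (block_mx 0 0 0 1%:M).

Lemma row_mx_swap n (s t : 'rV[R]_1) (v : 'rV[R]_n) :
  row_mx s (row_mx t v) *m swap_mx n = row_mx t (row_mx s v).
Proof.
rewrite /swap_mx mul_row_block mul_row_col mul_row_block mul_mx_row.
by rewrite !mulmx0 !mulmx1 addr0 !add0r add_row_mx !addr0 add0r.
Qed.

Lemma col_mx_swap n (s t : 'cV[R]_1) (v : 'cV[R]_n) :
  swap_mx n *m col_mx s (col_mx t v) = col_mx t (col_mx s v).
Proof.
rewrite /swap_mx mul_block_col mul_row_col mul_block_col mul_col_mx.
by rewrite !mul0mx !mul1mx !addr0 !add0r add_col_mx !addr0 add0r.
Qed.

Lemma swap_mxK n : swap_mx n *m swap_mx n = 1%:M.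
Proof.
rewrite /swap_mx mulmx_block mul_row_col mul_row_block mul_block_col.
rewrite mul_col_mx mulmx_block mul_mx_row !mulmx0 !mul0mx !mulmx1 !add0r !addr0.
rewrite row_mx0 col_mx0 mul_col_row !mulmx0 !mul0mx !mulmx1 add_block_mx !addr0 !add0r.
by rewrite -!scalar_mx_block.
Qed.

Lemma normr_det_involutive n (M : 'M[R]_n) : M *m M = 1%:M -> `|\det M| = 1.
Proof.
move=> /(congr1 determinant); rewrite det_mulmx det1 => /(congr1 Num.norm).
by rewrite normrM normr1 -expr2 => /eqP; rewrite sqrp_eq1// => /eqP.
Qed.

(** Tonelli for the two outermost integrals. *)
Lemma vol_swap n (f : 'rV[R]_(1 + (1 + n)) -> bool) : polyhedral f ->
  vol [set z | f (z *m swap_mx n)] = vol [set z | f z].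
Proof.
move=> pf /=.
pose V st := vol [set v | f (row_mx (const_mx st.1) (row_mx (const_mx st.2) v))].
transitivity (\int[mu]_s \int[mu]_t V (t, s))%E.
  apply: eq_integral => s _; apply: eq_integral => t _.
  congr vol; apply/seteqP.
  by split=> v /=; rewrite row_mx_swap.
rewrite -(fubini_tonelli (m1 := mu) (m2 := mu) V) //.
  exact: measurable_vol_section2.
by move=> st; exact: vol_ge0.
Qed.

(** The hypothesis is translation invariance; it removes [w] and will come from the block triangular
    case. *)
Lemma linear_change_swap n : linear_change (1%:M : 'M[R]_(1 + (1 + n))) ->
  linear_change (swap_mx n).
Proof.
move=> h1 f w pf; rewrite (normr_det_involutive (swap_mxK n)) invr1 mul1e.
have pg : polyhedral (fun z => f (z + w)).
  by apply: tree_ext (polyhedral_affine 1%:M w pf) => z; rewrite mulmx1.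
rewrite (vol_swap pg).
have := h1 f w pf; rewrite det1 normr1 invr1 mul1e => <-.
by congr vol; apply/seteqP; split => z /=; rewrite mulmx1.
Qed.

(** A nonzero column has rank 1, so its Gaussian factorization is an invertible matrix times the
    first basis column times a nonzero scalar. *)
Lemma unitmx_col n (c : 'cV[R]_(1 + n)) : c != 0 ->
  exists2 N, N \in unitmx & exists2 u, \det u != 0 & N *m c = col_mx u 0.
Proof.
move=> c0; exists (invmx (col_ebase c)).
  by rewrite unitmx_inv col_ebase_unit.
exists (row_ebase c); first by have := row_ebase_unit c; rewrite unitmxE unitfE.
have r1 : \rank c = 1%N.
  by apply/eqP; rewrite eqn_leq lt0n mxrank_eq0 c0 rank_leq_col.
have e := mulmx_ebase c; rewrite r1 -mulmxA in e.
rewrite -[in X in _ *m X]e mulKmx ?col_ebase_unit//.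
by rewrite (@pid_mx_col R n 1) mul_col_mx mul1mx mul0mx.
Qed.

(* Induction on the dimension.  If the first column of [M] is zero below its top entry, [M]
   is block triangular; otherwise, up to block triangular factors and the swap of the first
   two coordinates, [M] has this shape. *)
Lemma linear_change_unit n (M : 'M[R]_n) : M \in unitmx -> linear_change M.
Proof.
elim: n M => [|n IH] M uM.
  move=> f w pf; rewrite det_mx00 normr1 invr1 mul1e.
  congr vol; apply/seteqP.
  suff E z : z *m M + w = z by split=> z /=; rewrite E.
  by rewrite [LHS]thinmx0 [z]thinmx0.
have block (X : 'M[R]_(1 + n)) : X \in unitmx -> dlsubmx X = 0 -> linear_change X.
  rewrite -[X]submxK unitmxE unitfE block_mxKdl => + X0; rewrite X0 det_ublock.
  rewrite mulf_eq0 negb_or => /andP[ha hN].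
  by apply: linear_change_block => //; apply: IH; rewrite unitmxE unitfE.
rewrite -[n.+1]/(1 + n)%N in M uM *.
have [c0|c0] := eqVneq (dlsubmx M) 0; first exact: block.
case: n IH M uM c0 block => [|n] IH M uM c0 block.
  by rewrite flatmx0 eqxx in c0.
have h1 : linear_change (1%:M : 'M[R]_(1 + n.+1)).
  apply: block; first exact: unitmx1.
  by rewrite (scalar_mx_block 1 n.+1) block_mxKdl.
have [N uN [u u0 Nc]] := unitmx_col c0.
have uu : u \in unitmx by rewrite unitmxE unitfE.
(* Writing [m] for the top left entry of [M], the first column becomes [(m, u, 0)] after [P1]. Then
   [P2] subtracts [m / u] times the second row from the first, leaving [(0, u, 0)], and the swap
   yields [(u, 0, 0)]. *)
pose q := row_mx (ulsubmx M *m invmx u) 0 : 'rV[R]_(1 + n).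
pose P1 : 'M[R]_(1 + (1 + n)) := block_mx 1%:M 0 0 N.
pose P1' : 'M[R]_(1 + (1 + n)) := block_mx 1%:M 0 0 (invmx N).
pose P2 : 'M[R]_(1 + (1 + n)) := block_mx 1%:M (- q) 0 1%:M.
pose P2' : 'M[R]_(1 + (1 + n)) := block_mx 1%:M q 0 1%:M.
have K1 : P1' *m P1 = 1%:M.
  rewrite mulmx_block !mulmx0 !mul0mx !mul1mx ?mulmx1 mulVmx// !addr0 add0r.
  by rewrite -scalar_mx_block.
have K2 : P2' *m P2 = 1%:M.
  rewrite mulmx_block !mulmx0 !mul0mx !mul1mx ?mulmx1 !addr0 addNr add0r.
  by rewrite -scalar_mx_block.
pose X := swap_mx n *m (P2 *m (P1 *m M)).
have EM : M = P1' *m (P2' *m (swap_mx n *m X)).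
  by rewrite /X (mulmxA (swap_mx n)) swap_mxK mul1mx (mulmxA P2') K2 mul1mx (mulmxA P1') K1 mul1mx.
have unitl (A B : 'M[R]_(1 + (1 + n))) : A *m B = 1%:M -> A \in unitmx.
  by move=> /mulmx1_unit[].
have unitr (A B : 'M[R]_(1 + (1 + n))) : A *m B = 1%:M -> B \in unitmx.
  by move=> /mulmx1_unit[].
have uX : X \in unitmx.
  by rewrite !unitmx_mul (unitl _ _ (swap_mxK n)) (unitr _ _ K2) (unitr _ _ K1).
have X0 : dlsubmx X = 0.
  have El (Z : 'M[R]_(1 + (1 + n))) : lsubmx Z = col_mx (ulsubmx Z) (dlsubmx Z).
    by rewrite -[Z in LHS]submxK block_mxEh row_mxKl.
  have -> : dlsubmx X = dsubmx (lsubmx X) by rewrite El col_mxKd.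
  rewrite -!mulmx_lsub El mul_block_col Nc mul_block_col !mul1mx !mul0mx addr0 !add0r.
  rewrite mulNmx mul_row_col mul0mx addr0 mulmxKV// subrr.
  by rewrite col_mx_swap col_mxKd col_mx0.
rewrite EM; apply: linear_change_mul.
  by apply: block; [exact: (unitl _ _ K1)|rewrite block_mxKdl].
apply: linear_change_mul.
  by apply: block; [exact: (unitl _ _ K2)|rewrite block_mxKdl].
by apply: linear_change_mul; [exact: linear_change_swap|exact: block].
Qed.

End ChangeOfVariables.

(** * Piecewise rational functions *)

Import (canonicals) mpoly.

Section PiecewiseRational.
Variables (R : realType) (d : nat).
Implicit Types f g : 'rV[R]_d -> R.

Definition polyfun f := exists p : mpoly.mpoly d R,
  f = fun x => mpoly.meval (fun i => x 0 i) p.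

Lemma polyfun_cst c : polyfun (fun=> c).
Proof. by exists (mpoly.mpolyC d c); apply/funext => x; rewrite mpoly.mevalC. Qed.

Lemma polyfun_coord i : polyfun (fun x => x 0 i).
Proof.
exists (mpoly.mpolyX R (mpoly.mnm1 i)).
by apply/funext => x; rewrite mpoly.mevalXU.
Qed.

Lemma polyfunD f g : polyfun f -> polyfun g -> polyfun (fun x => f x + g x).
Proof.
move=> [p ->] [q ->]; exists (p + q).
by apply/funext => x; rewrite mpoly.mevalD.
Qed.

Lemma polyfunM f g : polyfun f -> polyfun g -> polyfun (fun x => f x * g x).
Proof.
move=> [p ->] [q ->]; exists (p * q).
by apply/funext => x; rewrite mpoly.mevalM.
Qed.

Lemma semialgebraic_le f : polyfun f -> semialgebraic [set x | 0 <= f x].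
Proof. by move=> [p ->]; exact: sa_le. Qed.

Lemma semialgebraic_eq0 f : polyfun f -> semialgebraic [set x | f x = 0].
Proof.
move=> pf; have pNf := polyfunM (polyfun_cst (-1)) pf.
suff -> : [set x | f x = 0] = [set x | 0 <= f x] `&` [set x | 0 <= -1 * f x].
  by apply: sa_inter; exact: semialgebraic_le.
apply/seteqP; split=> x /=; rewrite mulN1r oppr_ge0.
  by move=> ->; rewrite lexx.
by move=> [? ?]; apply/eqP; rewrite eq_le; apply/andP.
Qed.

(* Division is total, with x / 0 = 0, so a fraction needs no condition on its denominator. *)
Inductive pw_rational : ('rV[R]_d -> R) -> Prop :=
| pw_rational_frac f g : polyfun f -> polyfun g -> pw_rational (fun x => f x / g x)
| pw_rational_if S f g : semialgebraic S -> pw_rational f -> pw_rational g ->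
    pw_rational (fun x => if `[< S x >] then f x else g x).

Lemma pw_rational_ext f g : f =1 g -> pw_rational f -> pw_rational g.
Proof. by move=> /funext ->. Qed.

(** Case distinctions commute with [op] and are moved outwards, so only fractions have to be
    treated. *)
Lemma pw_rational_op2 (op : R -> R -> R) :
  (forall f1 g1 f2 g2, polyfun f1 -> polyfun g1 -> polyfun f2 -> polyfun g2 ->
    pw_rational (fun x => op (f1 x / g1 x) (f2 x / g2 x))) ->
  forall f g, pw_rational f -> pw_rational g -> pw_rational (fun x => op (f x) (g x)).
Proof.
move=> hop f g rf; elim: rf g => [f1 g1 pf1 pg1 g rg|S f1 f2 sS _ IH1 _ IH2 g rg].
  elim: rg => [f2 g2 pf2 pg2|S g2 g3 sS _ IH2 _ IH3]; first exact: hop.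
  by apply: pw_rational_ext (pw_rational_if sS IH2 IH3) => x; case: ifP.
by apply: pw_rational_ext (pw_rational_if sS (IH1 _ rg) (IH2 _ rg)) => x; case: ifP.
Qed.

Lemma pw_rational_poly f : polyfun f -> pw_rational f.
Proof.
move=> pf; apply: pw_rational_ext (pw_rational_frac pf (polyfun_cst 1)) => x.
by rewrite divr1.
Qed.

Lemma pw_rationalD f g : pw_rational f -> pw_rational g ->
  pw_rational (fun x => f x + g x).
Proof.
apply: pw_rational_op2 => f1 g1 f2 g2 pf1 pg1 pf2 pg2.
have h1 := pw_rational_frac pf1 pg1; have h2 := pw_rational_frac pf2 pg2.
have h12 := pw_rational_frac (polyfunD (polyfunM pf1 pg2) (polyfunM pf2 pg1))
  (polyfunM pg1 pg2).
(* The common denominator gives a wrong value when just one denominator vanishes, since that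
   fraction is then 0 and the other one should remain; hence the two tests. *)
apply: pw_rational_ext (pw_rational_if (semialgebraic_eq0 pg1) h2
  (pw_rational_if (semialgebraic_eq0 pg2) h1 h12)) => x /=.
case: asboolP => [->|/eqP g10]; first by rewrite invr0 mulr0 add0r.
case: asboolP => [->|/eqP g20]; first by rewrite invr0 mulr0 addr0.
by rewrite addf_div.
Qed.

Lemma pw_rationalM f g : pw_rational f -> pw_rational g ->
  pw_rational (fun x => f x * g x).
Proof.
apply: pw_rational_op2 => f1 g1 f2 g2 pf1 pg1 pf2 pg2.
apply: pw_rational_ext (pw_rational_frac (polyfunM pf1 pf2) (polyfunM pg1 pg2)).
by move=> x; rewrite mulf_div.
Qed.

Lemma pw_rationalV f : pw_rational f -> pw_rational (fun x => (f x)^-1).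
Proof.
elim=> [f1 g1 pf1 pg1|S f1 f2 sS _ IH1 _ IH2].
  by apply: pw_rational_ext (pw_rational_frac pg1 pf1) => x; rewrite invf_div.
by apply: pw_rational_ext (pw_rational_if sS IH1 IH2) => x; case: ifP.
Qed.

Lemma semialgebraic_pw_rational f : pw_rational f -> semialgebraic [set x | 0 <= f x].
Proof.
elim=> [f1 g1 pf1 pg1|S f1 f2 sS _ IH1 _ IH2].
  (* Quotient and product differ by the positive factor [g1 x ^+ 2], and both are 0 when
     [g1 x = 0]. *)
  suff -> : [set x | 0 <= f1 x / g1 x] = [set x | 0 <= f1 x * g1 x].
    exact/semialgebraic_le/polyfunM.
  apply/funext => x /=; congr is_true.
  have [->|g0] := eqVneq (g1 x) 0; first by rewrite invr0 !mulr0.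
  rewrite -[RHS](pmulr_lge0 _ (x := (g1 x)^-1 ^+ 2)); last first.
    by rewrite exprn_even_gt0// invr_eq0.
  by congr (_ <= _); field.
suff -> : [set x | 0 <= (if `[< S x >] then f1 x else f2 x)] =
    (S `&` [set x | 0 <= f1 x]) `|` (~` S `&` [set x | 0 <= f2 x]).
  by apply: sa_union; apply: sa_inter => //; exact: sa_compl.
apply/seteqP; split=> x /=.
  by case: asboolP; [left|right].
by case=> -[]; case: asboolP.
Qed.

Lemma pw_rational_field : coeff_field pw_rational.
Proof.
split; [|exact: pw_rationalD|exact: pw_rationalM|exact: pw_rationalV].
by move=> c; exact/pw_rational_poly/polyfun_cst.
Qed.

(** Starting point of the iteration: before a coordinate of [w] is introduced, coefficients, forms
    and leaves are one and the same class. *)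
Lemma pw_rational_forms : forms pw_rational pw_rational.
Proof. by split=> //; [exact: pw_rationalD|exact: pw_rationalM]. Qed.

Lemma pw_rational_module : form_module pw_rational pw_rational.
Proof.
split; [|exact: pw_rationalD|exact: pw_rationalM].
by move=> c; exact/pw_rational_poly/polyfun_cst.
Qed.

Lemma pw_rational_tree f : tree pw_rational pw_rational f -> pw_rational f.
Proof.
elim=> // a f1 f2 /semialgebraic_pw_rational sa _ IH1 _ IH2.
apply: pw_rational_ext (pw_rational_if sa IH1 IH2) => x /=.
by rewrite asboolb.
Qed.

Lemma pw_rational_sum (I : Type) (r : seq I) (F : I -> 'rV[R]_d -> R) :
  (forall i, pw_rational (F i)) -> pw_rational (fun x => \sum_(i <- r) F i x).
Proof.
move=> hF; elim: r => [|i r IH].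
  under [X in pw_rational X]funext do rewrite big_nil.
  exact/pw_rational_poly/polyfun_cst.
under [X in pw_rational X]funext do rewrite big_cons.
exact: pw_rationalD.
Qed.

End PiecewiseRational.

(** * Polytopes and frames *)

Section Hull.
Variables (R : realType) (d : nat).

Definition hom_affine (g : 'rV[R]_d * R -> R) :=
  exists (k : 'cV[R]_d) c e, g = fun ys => (ys.1 *m k) 0 0 + c * ys.2 + e.

Lemma const_field Y : coeff_field (@is_const Y R).
Proof.
split.
- by move=> c; exists c.
- by move=> _ _ [a ->] [b ->]; exists (a + b).
- by move=> _ _ [a ->] [b ->]; exists (a * b).
- by move=> _ [a ->]; exists a^-1.
Qed.

Lemma hom_affine_forms : forms (@is_const _ R) hom_affine.
Proof.
split.
- move=> _ [a ->]; exists 0, 0, a.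
  by apply/funext => y; rewrite mulmx0 mxE mul0r !add0r.
- move=> _ _ [k [c [e ->]]] [k' [c' [e' ->]]].
  exists (k + k'), (c + c'), (e + e').
  apply/funext => y.
  have -> : (y.1 *m (k + k')) 0 0 = (y.1 *m k) 0 0 + (y.1 *m k') 0 0.
    by rewrite mulmxDr mxE.
  by ring.
- move=> _ _ [a ->] [k [c [e ->]]]; exists (a *: k), (a * c), (a * e).
  apply/funext => y.
  have -> : (y.1 *m (a *: k)) 0 0 = a * (y.1 *m k) 0 0 by rewrite -scalemxAr mxE.
  by ring.
Qed.

Lemma tree_eq0 Y (A : (Y -> R) -> Prop) g :
  forms (@is_const _ R) A -> A g ->
  tree A (@is_const _ bool) (fun y => g y == 0).
Proof.
move=> hA Ag; have ANg := forms_mul hA (ex_intro _ (-1) erefl) Ag.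
have tcst b : tree A (@is_const _ bool) (fun=> b) by apply: tree_leaf; exists b.
apply: tree_ext (tree_node Ag (tree_node ANg (tcst true) (tcst false)) (tcst false)) => y /=.
by rewrite mulN1r oppr_ge0; case: ltgtP.
Qed.

Lemma tree_andb Y (A : (Y -> R) -> Prop) f g :
  tree A (@is_const _ bool) f -> tree A (@is_const _ bool) g ->
  tree A (@is_const _ bool) (fun y => f y && g y).
Proof. by apply: tree_op2 => _ _ [b ->] [c ->]; exists (b && c). Qed.

Lemma tree_all Y (A : (Y -> R) -> Prop) (I : Type) (r : seq I) (f : I -> Y -> bool) :
  (forall i, tree A (@is_const _ bool) (f i)) ->
  tree A (@is_const _ bool) (fun y => all (f^~ y) r).
Proof.
move=> hf; elim: r => [|i r IH] /=; first by apply: tree_leaf; exists true.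
exact: tree_andb.
Qed.

(** The total weight is an extra coordinate, so that removing one generator leads to a condition of
    the same kind; weight 1 gives the polytope. *)
Definition cone m (V : 'M[R]_(m, d)) (ys : 'rV[R]_d * R) :=
  exists lam : 'rV[R]_m,
    [/\ forall i, 0 <= lam 0 i, \sum_i lam 0 i = ys.2 & ys.1 = lam *m V].

(* Fourier-Motzkin elimination of the weight of one generator at a time. *)
Lemma cone_tree m (V : 'M[R]_(m, d)) :
  exists2 f, tree hom_affine (@is_const _ bool) f & forall ys, f ys <-> cone V ys.
Proof.
have hK := @const_field ('rV[R]_d * R); have hA := hom_affine_forms.
elim: m V => [|m IH] V.
  exists (fun ys : 'rV[R]_d * R => all (fun i => ys.1 0 i == 0) (enum 'I_d) && (ys.2 == 0)).
    apply: tree_andb.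
      apply: (@tree_all _ _ _ _ (fun i (ys : 'rV[R]_d * R) => ys.1 0 i == 0)) => i; apply: tree_eq0 => //.
      exists (delta_mx i 0), 0, 0; apply/funext => y.
      by rewrite -colE mxE mul0r !addr0.
    apply: tree_eq0 => //; exists 0, 1, 0; apply/funext => y.
    by rewrite mulmx0 mxE add0r mul1r addr0.
  move=> [y s] /=; split.
    move=> /andP[/allP y0 /eqP ->]; exists 0; split.
    - by move=> i; rewrite mxE.
    - by rewrite big_ord0.
    - rewrite mul0mx; apply/rowP => i; rewrite mxE.
      by apply/eqP/y0; rewrite mem_enum.
  move=> [lam [_ /= <- ->]]; rewrite big_ord0 eqxx andbT.
  by apply/allP => i _; rewrite [V]flatmx0 mulmx0 mxE.
rewrite -[m.+1]/(1 + m)%N in V *.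
have [f tf hf] := IH (dsubmx V).
pose v := usubmx V.
(* What remains of the point and of the total weight once the first generator [v] has received
   weight [w.2]. *)
pose h (w : ('rV[R]_d * R) * R) := (w.1.1 - w.2 *: v, w.1.2 - w.2).
have tfh : tree (ext_form (@is_const _ R) hom_affine) (@is_const _ bool) (f \o h).
  apply: tree_pull tf; last by move=> _ [b ->]; exists b.
  move=> _ [k [c [e ->]]].
  exists (fun ys => (ys.1 *m k) 0 0 + c * ys.2 + e), (fun=> - (v *m k) 0 0 - c).
  split; [by exists k, c, e|by eexists|apply/funext => w /=].
  by rewrite mulmxBl -scalemxAl !mxE; ring.
have hl : bound_form hom_affine (fun=> BLeft 0).
  exists true, (fun=> 0); split=> //.
  by apply: forms_coeff hA _ _; exists 0.
(* The other weights are nonnegative, so the eliminated one cannot exceed the total; this supplies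
   the bounded interval that the elimination requires. *)
have hu : bound_form hom_affine (fun ys => BRight ys.2).
  exists false, snd; split=> //; exists 0, 1, 0.
  by apply/funext => y; rewrite mulmx0 mxE add0r mul1r addr0.
apply: ex_intro2 (tree_exists hK hA hl hu tfh) _ => -[y s]; split.
  move=> /asboolP[t]; rewrite in_itv/= => /andP[t0 ts] /hf[lam [lam0 /= slam Elam]].
  exists (row_mx (const_mx t : 'rV[R]_1) lam); split=> /=.
  - move=> i; rewrite mxE; case: splitP => j _; [by rewrite mxE|exact: lam0].
  - rewrite (@big_split_ord _ _ _ 1 m)/= big_ord1 row_mxEl mxE.
    under eq_bigr do rewrite row_mxEr.
    by rewrite slam addrC subrK.
  - rewrite -[V]vsubmxK mul_row_col -Elam addrC.
    suff -> : (const_mx t : 'rV[R]_1) *m usubmx V = t *: v by rewrite subrK.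
    by apply/rowP => j; rewrite !mxE big_ord1 !mxE.
move=> [lam [lam0 /= <- ->]].
apply/asboolP; exists (lam 0 (lshift m (ord0 : 'I_1))).
  rewrite in_itv/= lam0 /= (@big_split_ord _ _ _ 1 m)/= big_ord1 lerDl.
  exact: sumr_ge0.
apply/hf; exists (rsubmx lam); split=> /=.
- by move=> i; rewrite mxE.
- rewrite (@big_split_ord _ _ _ 1 m)/= big_ord1 addrC addrK.
  by apply: eq_bigr => i _; rewrite mxE.
- have -> : lam *m V = lsubmx lam *m usubmx V + rsubmx lam *m dsubmx V.
    by rewrite -mul_row_col hsubmxK vsubmxK.
  suff -> : lsubmx lam *m usubmx V = lam 0 (lshift m (ord0 : 'I_1)) *: v.
    by rewrite addrAC subrr add0r.
  by apply/rowP => j; rewrite !mxE big_ord1 !mxE.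
Qed.

Lemma polytope_polyhedral (P : set 'rV[R]_d) : is_polytope P ->
  exists2 f, polyhedral f & P = [set y | f y].
Proof.
move=> [m [V ->]]; have [f tf hf] := cone_tree V.
exists (fun y => f (y, 1)).
  apply: (tree_pull (h := fun y => (y, 1))) tf; last by move=> _ [b ->]; exists b.
  move=> _ [k [c [e ->]]]; exists (c + e), k.
  by apply/funext => y /=; ring.
apply/seteqP; split=> y /=.
  by move=> [lam [? [? ?]]]; apply/hf; exists lam.
by move=> /hf[lam [? ? ?]]; exists lam.
Qed.

(** Nonnegative weights with sum 1 are at most 1 each, so the sum of the absolute values of all
    entries of [V] is a bound. *)
Lemma polytope_bounded (P : set 'rV[R]_d) : is_polytope P ->
  exists M, forall y, P y -> forall j, `|y 0 j| <= M.
Proof.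
move=> [m [V ->]]; exists (\sum_i \sum_j `|V i j|) => _ [lam [lam0 [lam1 ->]]] j.
rewrite mxE (le_trans (ler_norm_sum _ _ _))//; apply: ler_sum => i _.
rewrite normrM ger0_norm// (le_trans (y := `|V i j|))//.
  rewrite ler_piMl// -lam1 (bigD1 i)//= lerDl; exact: sumr_ge0.
rewrite (bigD1 j)//= lerDl; exact: sumr_ge0.
Qed.

End Hull.

Section Frame.
Variable R : realType.

Definition sqnorm d (x : 'rV[R]_d) : R := \sum_i x 0 i ^+ 2.

Lemma sqnormE d (x : 'rV[R]_d) : x *m x^T = (sqnorm x)%:M.
Proof.
rewrite [LHS]mx11_scalar; congr _%:M; rewrite mxE.
by apply: eq_bigr => i _; rewrite mxE expr2.
Qed.

Lemma sqnorm_ge0 d (x : 'rV[R]_d) : 0 <= sqnorm x.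
Proof. by apply: sumr_ge0 => i _; exact: sqr_ge0. Qed.

Lemma sqnorm_eq0 d (x : 'rV[R]_d) : (sqnorm x == 0) = (x == 0).
Proof.
apply/eqP/eqP => [/eqP|->]; last first.
  by rewrite /sqnorm big1// => i _; rewrite mxE expr0n.
rewrite psumr_eq0 => [/allP h|i _]; last exact: sqr_ge0.
apply/rowP => i; rewrite mxE; apply/eqP; rewrite -(sqrf_eq0 (x 0 i)).
by have /implyP := h i (mem_index_enum _); exact.
Qed.

(* Rows 2, ..., d of the Householder reflection exchanging the first basis vector and x / |x|. *)
Lemma perp_frame_exists d (x : 'rV[R]_(1 + d)) : x != 0 ->
  exists B : 'M[R]_(d, 1 + d), perp_frame x B.
Proof.
move=> x0.
have n0 : sqnorm x != 0 by rewrite sqnorm_eq0.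
pose r := Num.sqrt (sqnorm x).
have r2 : r ^+ 2 = sqnorm x by rewrite sqr_sqrtr ?sqnorm_ge0.
have r0 : r != 0 by apply: contra_neq n0 => r0; rewrite -r2 r0 expr0n.
pose u := r^-1 *: x.
have uu : u *m u^T = 1%:M.
  rewrite /u linearZ/= -scalemxAl -scalemxAr sqnormE -r2 !scale_scalar_mx.
  by congr _%:M; field.
pose e : 'rV[R]_(1 + d) := row_mx 1%:M 0.
have ee : e *m e^T = 1%:M.
  by rewrite /e tr_row_mx mul_row_col trmx0 trmx1 mulmx0 mulmx1 addr0.
have eu : e *m u^T = u *m e^T.
  by rewrite [LHS]mx11_scalar [RHS]mx11_scalar -[e *m u^T]trmxK trmx_mul !trmxK mxE.
have [w Ew] : exists w, w = u - e by exists (u - e).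
(* If [x / |x|] is already the first basis vector, then [w = 0], [c = 0] and [H] is the identity. *)
pose c := 2 / sqnorm w.
pose H := 1%:M - c *: (w^T *m w).
have HT : H^T = H.
  by rewrite /H linearB/= linearZ/= trmx_mul trmxK trmx1.
have HH : H *m H^T = 1%:M.
  rewrite HT /H mulmxBl mul1mx mulmxBr mulmx1 -scalemxAl -scalemxAr.
  rewrite -!mulmxA (mulmxA w) sqnormE mul_scalar_mx -!scalemxAr !scalerA.
  rewrite -addrA -opprD -scalerBl -scalerDl.
  suff -> : c + (c - c * (c * sqnorm w)) = 0 by rewrite scale0r subr0.
  rewrite /c; have [->|w0] := eqVneq (sqnorm w) 0; first by rewrite invr0; ring.
  by field.
have eH : e *m H = u.
  rewrite /H mulmxBr mulmx1 -scalemxAr mulmxA.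
  have [w0|w0] := eqVneq w 0.
    rewrite w0 mulmx0 scaler0 subr0; apply/esym/eqP.
    by rewrite -subr_eq0 -Ew w0.
  (* As [e] and [u] are unit vectors, [|u - e|^2 = 2 - 2 <e, u> = - 2 <e, w>]. *)
  have ew : e *m w^T = - (sqnorm w / 2)%:M.
    have : w *m w^T = - (2%:R *: (e *m w^T)).
      rewrite Ew linearB/= mulmxBl !mulmxBr uu ee eu.
      by move: (u *m e^T) => A; apply/matrixP => k l; rewrite !mxE; ring.
    rewrite sqnormE => h.
    have -> : e *m w^T = 2^-1 *: (2%:R *: (e *m w^T)) by rewrite scalerA mulVf ?scale1r// pnatr_eq0.
    by rewrite -[2%:R *: _]opprK -h scalerN scale_scalar_mx mulrC.
  rewrite ew mulNmx mul_scalar_mx scalerN opprK scalerA.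
  have -> : c * (sqnorm w / 2) = 1.
    by rewrite /c; field; rewrite sqnorm_eq0.
  by rewrite scale1r Ew addrC subrK.
have uH : usubmx H = u.
  by rewrite -eH /e -[H in RHS]vsubmxK mul_row_col mul1mx mul0mx addr0.
(* The first row of the orthogonal matrix [H] is [u], so the blocks of [H *m H^T = 1%:M] say that
   the other rows are orthonormal and orthogonal to [u]. *)
have [B EB] : exists B, H = col_mx u B by exists (dsubmx H); rewrite -uH vsubmxK.
exists B; move: HH; rewrite EB tr_col_mx mul_col_row (scalar_mx_block 1 d).
move=> /eq_block_mx[_ _ Bu BB]; split; first exact: BB.
have -> : x = r *: u by rewrite /u scalerA divff// scale1r.
by rewrite linearZ/= -scalemxAr Bu scaler0.
Qed.

End Frame.

(** * Slabs *)

Section Slab.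
Variables (R : realType).
Local Notation mu := (@lebesgue_measure R).

Definition perp_proj d (x : 'rV[R]_d) : 'M[R]_d :=
  1%:M - (sqnorm x)^-1 *: (x^T *m x).

(** Written through [<w, x>] and the squared norm, so no square root occurs and all coefficients are
    rational in [x]. *)
Definition slab d (f : 'rV[R]_d -> bool) (xw : 'rV[R]_d * 'rV[R]_d) : bool :=
  f (xw.2 *m perp_proj xw.1) &&
  (0 <= (xw.2 *m xw.1^T) 0 0 <= sqnorm xw.1).

Lemma polyfun_sqnorm d : polyfun (@sqnorm R d).
Proof.
rewrite /sqnorm; elim: (index_enum _) => [|i r IH].
  by under [X in polyfun X]funext do rewrite big_nil; exact: polyfun_cst.
under [X in polyfun X]funext do rewrite big_cons expr2.
by apply: polyfunD => //; apply: polyfunM; exact: polyfun_coord.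
Qed.

Lemma slab_tree d (f : 'rV[R]_d -> bool) : polyhedral f ->
  tree (@lin_form R _ (@pw_rational R d) (@pw_rational R d) d) (@is_const _ _) (slab f).
Proof.
move=> pf.
have pcoord i : pw_rational (fun x : 'rV[R]_d => x 0 i).
  exact/pw_rational_poly/polyfun_coord.
have pcst c : pw_rational (fun _ : 'rV[R]_d => c).
  exact/pw_rational_poly/polyfun_cst.
have pn : pw_rational (@sqnorm R d) by exact/pw_rational_poly/polyfun_sqnorm.
have tcst b : tree (@lin_form R _ (@pw_rational R d) (@pw_rational R d) d)
    (@is_const _ bool) (fun=> b) by apply: tree_leaf; exists b.
apply: tree_andb; [|apply: tree_andb].
- apply: (tree_pull (h := fun xw => xw.2 *m perp_proj xw.1)) pf; last first.
    by move=> _ [b ->]; exists b.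
  move=> _ [c [k ->]]; exists (fun=> c), (fun x => perp_proj x *m k); split=> //.
    move=> j; under [X in pw_rational X]funext do rewrite mxE.
    apply: pw_rational_sum => i; apply: pw_rationalM => //.
    under [X in pw_rational X]funext do rewrite !mxE big_ord1 !mxE.
    apply: pw_rationalD => //.
    under [X in pw_rational X]funext do rewrite -mulN1r.
    apply: pw_rationalM => //; apply: pw_rationalM; first exact: pw_rationalV.
    exact: pw_rationalM.
  by apply/funext => xw /=; rewrite mulmxA.
- have Al : lin_form (@pw_rational R d) (@pw_rational R d)
      (fun xw : 'rV[R]_d * 'rV[R]_d => (xw.2 *m xw.1^T) 0 0).
    exists (fun=> 0), trmx; split=> //; last by apply/funext => xw; rewrite add0r.
    by move=> j; under [X in pw_rational X]funext do rewrite mxE.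
  by apply: tree_ext (tree_node Al (tcst true) (tcst false)) => xw /=; case: ifP.
- have Al : lin_form (@pw_rational R d) (@pw_rational R d)
      (fun xw : 'rV[R]_d * 'rV[R]_d => sqnorm xw.1 - (xw.2 *m xw.1^T) 0 0).
    exists (@sqnorm R d), (fun x => - x^T); split=> //; last first.
      by apply/funext => xw; rewrite mulmxN [X in _ = _ + X]mxE.
    move=> j; under [X in pw_rational X]funext do rewrite !mxE -mulN1r.
    exact: pw_rationalM.
  apply: tree_ext (tree_node Al (tcst true) (tcst false)) => xw /=.
  by rewrite subr_ge0; case: ifP.
Qed.

(** A point of the slab is its projection plus [c *: x] with [0 <= c <= 1]. The entries of [x] are
    bounded by [1 + sqnorm x] rather than by the norm because the bound must be piecewise rational
    in [x]. *)
Lemma slab_bounded d (f : 'rV[R]_d -> bool) M :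
  (forall y, f y -> forall j, `|y 0 j| <= M) ->
  forall x w, slab f (x, w) -> forall j, `|w 0 j| <= M + (1 + sqnorm x).
Proof.
move=> bf x w /= /andP[/bf /= bw /andP[w0 w1]] j.
pose c := (sqnorm x)^-1 * (w *m x^T) 0 0.
have Ew : w = w *m perp_proj x + c *: x.
  rewrite /perp_proj mulmxBr mulmx1 -scalemxAr mulmxA [w *m x^T]mx11_scalar.
  by rewrite mul_scalar_mx scalerA subrK.
rewrite Ew mxE (le_trans (ler_normD _ _))// lerD//.
have c01 : `|c| <= 1.
  have [x0|x0] := eqVneq (sqnorm x) 0; first by rewrite /c x0 invr0 mul0r normr0.
  have xp : 0 < sqnorm x by rewrite lt_neqAle eq_sym x0 sqnorm_ge0.
  rewrite ger0_norm /c; last by rewrite mulr_ge0// invr_ge0 ltW.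
  by rewrite mulrC ler_pdivrMr// mul1r.
rewrite mxE normrM (le_trans (y := `|x 0 j|))//; first by rewrite ler_piMl.
rewrite (le_trans (y := 1 + x 0 j ^+ 2))//.
  by rewrite -real_normK ?num_real//; nra.
rewrite lerD2l /sqnorm (bigD1 j)//= lerDl; apply: sumr_ge0 => i _; exact: sqr_ge0.
Qed.

Lemma polyhedral_fibre Y (A K : (Y -> R) -> Prop) n (f : Y * 'rV[R]_n -> bool) y :
  tree (lin_form A K (n:=n)) (@is_const _ _) f -> polyhedral (fun z => f (y, z)).
Proof.
apply: (tree_pull (h := fun z => (y, z))); last by move=> _ [b ->]; exists b.
by move=> _ [a [k [_ _ ->]]]; exists (a y), (k y).
Qed.

Lemma vol_slab d (f : 'rV[R]_d.+1 -> bool) (x : 'rV[R]_d.+1)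
    (B : 'M[R]_(d, d.+1)) : polyhedral f -> x != 0 -> perp_frame x B ->
  vol [set w | slab f (x, w)] = ((enorm x)%:E * vol [set z | f (z *m B)])%E.
Proof.
move=> pf x0 [BB Bx].
have n0 : sqnorm x != 0 by rewrite sqnorm_eq0.
have [r Er] : exists r, r = enorm x by exists (enorm x).
have r2 : sqnorm x = r ^+ 2 by rewrite Er sqr_sqrtr ?sqnorm_ge0.
have r_ge0 : 0 <= r by rewrite Er sqrtr_ge0.
have r0 : r != 0 by apply: contra_neq n0 => r0; rewrite r2 r0 expr0n.
have r_gt0 : 0 < r by rewrite lt_neqAle eq_sym r0.
have [u Eu] : exists u, u = r^-1 *: x by exists (r^-1 *: x).
have ux : u *m x^T = r%:M.
  rewrite Eu -scalemxAl sqnormE r2 scale_scalar_mx.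
  by congr _%:M; field.
have uu : u *m u^T = 1%:M.
  have -> : u^T = r^-1 *: x^T by rewrite Eu linearZ.
  rewrite -scalemxAr ux scale_scalar_mx.
  by rewrite mulVf.
have Bu : B *m u^T = 0 by rewrite Eu linearZ/= -scalemxAr Bx scaler0.
(* Orthogonal, hence volume preserving. In the coordinates [(t, v)] the product with [x] is [t * r],
   so the slab condition becomes [0 <= t <= r], independently of [v]. *)
pose O : 'M[R]_d.+1 := col_mx u B.
have OO : O *m O^T = 1%:M.
  change (col_mx u B *m (col_mx u B)^T = 1%:M).
  rewrite tr_col_mx mul_col_row uu BB Bu.
  by rewrite -[u *m B^T]trmxK trmx_mul trmxK Bu trmx0 -scalar_mx_block.
have uO : O \in unitmx by have /mulmx1_unit[] := OO.
have dO : `|\det O| = 1.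
  have := congr1 determinant OO; rewrite det_mulmx det_tr det1 => /(congr1 Num.norm).
  by rewrite normrM normr1 -expr2 => /eqP; rewrite sqrp_eq1// => /eqP.
have := linear_change_unit uO 0 (polyhedral_fibre x (slab_tree pf)).
rewrite dO invr1 mul1e => <- /=.
set V := vol [set z | f (z *m B)].
have E t v : slab f (x, (row_mx (const_mx t : 'rV[R]_1) v : 'rV[R]_d.+1) *m O + 0) =
    f (v *m B) && (0 <= t <= r).
  have -> : (row_mx (const_mx t : 'rV[R]_1) v : 'rV[R]_d.+1) *m O = t *: u + v *m B.
    rewrite [LHS](mul_row_col (const_mx t) v u B); congr (_ + _).
    by apply/rowP => j; rewrite !mxE big_ord1 !mxE.
  rewrite /slab/= addr0.
  have -> : (t *: u + v *m B) *m x^T = (t * r)%:M.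
    by rewrite mulmxDl -!scalemxAl ux -mulmxA Bx mulmx0 addr0 scale_scalar_mx.
  have -> : (t *: u + v *m B) *m perp_proj x = v *m B.
    rewrite /perp_proj mulmxBr mulmx1 -scalemxAr mulmxA mulmxDl -scalemxAl ux.
    rewrite -mulmxA Bx mulmx0 addr0 -scalemxAl mul_scalar_mx !scalerA r2.
    rewrite Eu scalerA (_ : r ^- 2 * t * r = t / r); last by field.
    by rewrite addrAC subrr add0r.
  rewrite mxE eqxx mulr1n r2 expr2 ler_pM2r//.
  by rewrite pmulr_lge0.
transitivity (\int[mu]_(t in `[0%R, r]) V)%E; last first.
  by rewrite integral_cst//= lebesgue_measure_itv/= lte_fin r_gt0 -EFinD subr0 muleC Er.
rewrite [RHS]integral_mkcond; apply: eq_integral => t _; rewrite patchE.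
case: ifPn => [|]; rewrite ?notin_setE ?inE /= in_itv/= => tr.
  by congr vol; apply/seteqP; split=> v /=; rewrite E tr andbT.
rewrite (_ : [set v | _] = set0) ?vol_set0//.
by apply/seteqP; split=> v //=; rewrite E => /andP[_ /tr].
Qed.

End Slab.

(** * Semialgebraicity of the intersection body *)

Theorem theorem2p6 (R : realType) (d : nat) (P : set 'rV[R]_d) :
  is_polytope P -> full_dimensional P -> P 0 ->
  semialgebraic (intersection_body P).
Proof.
move=> polP _ _.
(* In dimension 0 the only vector is 0, which belongs to the intersection body by definition; frames
   are available from dimension 1 on. *)
case: d P polP => [|d] P polP.
  suff -> : intersection_body P = [set x | 0 <= (fun=> 0 : R) x].
    exact/semialgebraic_le/polyfun_cst.
  apply/seteqP; split=> x _ /=; first exact: lexx.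
  by right; rewrite [x]thinmx0.
have [f pf PE] := polytope_polyhedral polP.
have [M bM] := polytope_bounded polP.
have psq : pw_rational (@sqnorm R d.+1) by exact/pw_rational_poly/polyfun_sqnorm.
have pcst c : pw_rational (fun _ : 'rV[R]_d.+1 => c).
  exact/pw_rational_poly/polyfun_cst.
have [V /pw_rational_tree pV hV] : exists2 V, tree (@pw_rational R d.+1) (@pw_rational R d.+1) V &
    forall x, vol [set w | slab f (x, w)] = (V x)%:E.
  apply: (vol_tree (M := fun x => M + (1 + sqnorm x)) (@pw_rational_field R d.+1)
    (@pw_rational_forms R d.+1) (@pw_rational_module R d.+1) _ (slab_tree pf)).
    by apply: pw_rationalD => //; exact: pw_rationalD.
  by apply: slab_bounded => y fy; apply: bM; rewrite PE.
have sz := semialgebraic_eq0 (@polyfun_sqnorm R d.+1).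
have pdiff := pw_rationalD pV (pw_rationalM (pcst (-1)) psq).
suff -> : intersection_body P =
    (~` [set x | sqnorm x = 0] `&` [set x | 0 <= V x + -1 * sqnorm x]) `|`
    [set x | sqnorm x = 0].
  apply: sa_union => //; apply: sa_inter; first exact: sa_compl.
  exact: semialgebraic_pw_rational.
have key x : x != 0 -> (1 <= radial_IK P x)%E = (0 <= V x + -1 * sqnorm x).
  move=> x0; rewrite /radial_IK /section_vol PE /=.
  (* The default 0 of [xget] is ruled out by the existence of some frame; which frame gets chosen is
     irrelevant, as [vol_slab] holds for all of them. *)
  have frame : perp_frame x (xget 0 (perp_frame x)).
    have [B hB] := perp_frame_exists x0.
    exact: (@xgetPex _ 0 (perp_frame x) (ex_intro _ B hB)).
  have r2 : sqnorm x = enorm x ^+ 2 by rewrite sqr_sqrtr ?sqnorm_ge0.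
  have r_gt0 : 0 < enorm x.
    by rewrite sqrtr_gt0 lt_neqAle eq_sym sqnorm_eq0 x0 sqnorm_ge0.
  have := vol_slab pf x0 frame; rewrite hV => /(congr1 (fun y => (enorm x)^-1%:E * y)%E).
  rewrite muleA -!EFinM mulVf ?gt_eqF// mul1e => <-.
  (* The slab volume is divided by the norm twice, once to recover the section and once in the
     radial function; hence the comparison with the squared norm. *)
  rewrite -EFinM lee_fin mulN1r subr_ge0 r2 expr2.
  by rewrite ler_pdivlMr// mul1r mulrC ler_pdivlMr.
apply/seteqP; split=> x /=.
  move=> [[x0 h]|->]; last by right; apply/eqP; rewrite sqnorm_eq0.
  left; split; last by rewrite -key.
  by apply/eqP; rewrite sqnorm_eq0.
move=> [[/eqP]|/eqP]; rewrite sqnorm_eq0 => x0; last by right; exact/eqP.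
by move=> h; left; split; rewrite ?key.
Qed.
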